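(* Let $F$ be a field of characteristic $p>0$ and let $G$ be a finite group. Suppose that one of the following holds: (i) $G' \subseteq Z(O_p(G))$; or (ii) $p=2$ and $G' \subseteq Y(O_p(G))\,Z(O_p(G))$. Then $\operatorname{soc}(ZFG)$ is an ideal in $FG$.
   Context: $FG$ is the group algebra of $G$ over $F$, $ZFG$ is its center, and ''ideal'' of $FG$ means two-sided ideal. $\operatorname{soc}(ZFG)$ denotes the socle of the commutative finite-dimensional algebra $ZFG$, i.e. the sum of its minimal ideals; equivalently, the annihilator in $ZFG$ of the Jacobson radical $J(ZFG)$. $G'$ is the derived subgroup of $G$, $O_p(G)$ is the $p$-core (largest normal $p$-subgroup) of $G$, and $Z(X)$ is the center of a group $X$. For a finite $2$-group $Q$, $Y(Q) := \langle fg^{-1} : \{f,g\} \text{ is a conjugacy class of length } 2 \text{ of } Q\rangle$. *)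

(* Defs.v *)
From HB Require Import structures.
From mathcomp Require Import all_boot all_order all_fingroup all_algebra.
From mathcomp Require Import all_solvable all_field.
From mathcomp Require boolp.

Set Implicit Arguments.
Unset Strict Implicit.
Unset Printing Implicit Defensive.

Import GRing.Theory.
Local Open Scope ring_scope.

(* u : group_algebra F gT stands for the formal sum of the u g *: g.  The
   alias hides the pointwise product of {ffun gT -> F}. *)
Definition group_algebra (F : fieldType) (gT : finGroupType) : Type :=
  {ffun gT -> F}.

Section GroupAlgebra.
Variables (F : fieldType) (gT : finGroupType).
Local Notation FG := (group_algebra F gT).
Implicit Types u v w : FG.

(* F^o is F viewed as a vector space over itself. *)
HB.instance Definition _ := Vector.copy FG {ffun gT -> F^o}.

Definition ga_one : FG := [ffun g => (g == 1%g)%:R].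
Definition ga_mul u v : FG := [ffun g => \sum_h u h * v (h^-1 * g)%g].

Fact ga_mulA : associative ga_mul.
Proof.
move=> u v w; apply/ffunP=> g; rewrite !ffunE.
under eq_bigr => h _ do rewrite ffunE mulr_sumr.
under [RHS]eq_bigr => h _ do rewrite ffunE mulr_suml.
rewrite [RHS]exchange_big /=; apply: eq_bigr => h _.
rewrite [RHS](reindex_inj (mulgI h)) /=; apply: eq_bigr => k _.
by rewrite mulKg mulrA invMg mulgA.
Qed.

Fact ga_mul1l : left_id ga_one ga_mul.
Proof.
move=> u; apply/ffunP=> g; rewrite !ffunE (bigD1 1%g) //= ffunE eqxx mul1r.
rewrite big1 ?addr0 ?invg1 ?mul1g // => h /negPf nh1.
by rewrite ffunE nh1 mul0r.
Qed.

Fact ga_mul1r : right_id ga_one ga_mul.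
Proof.
move=> u; apply/ffunP=> g; rewrite !ffunE (bigD1 g) //= ffunE mulVg eqxx mulr1.
rewrite big1 ?addr0 // => h nhg.
by rewrite ffunE -eq_mulVg1 (negPf nhg) mulr0.
Qed.

Fact ga_mulDl : left_distributive ga_mul +%R.
Proof.
move=> u v w; apply/ffunP=> g; rewrite !ffunE -big_split /=.
by apply: eq_bigr => h _; rewrite ffunE mulrDl.
Qed.

Fact ga_mulDr : right_distributive ga_mul +%R.
Proof.
move=> u v w; apply/ffunP=> g; rewrite !ffunE -big_split /=.
by apply: eq_bigr => h _; rewrite ffunE mulrDr.
Qed.

Fact ga_one_neq0 : ga_one != 0.
Proof. by apply/eqP=> /ffunP/(_ 1%g)/eqP; rewrite !ffunE eqxx oner_eq0. Qed.

HB.instance Definition _ := GRing.Zmodule_isNzRing.Build FG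
  ga_mulA ga_mul1l ga_mul1r ga_mulDl ga_mulDr ga_one_neq0.

Lemma ga_scaleE (a : F) u g : (a *: u) g = a * u g.
Proof. exact: ffunE. Qed.

Fact ga_scaleAl (a : F) u v : a *: (u * v) = (a *: u) * v.
Proof.
apply/ffunP=> g; rewrite ga_scaleE !ffunE mulr_sumr.
by apply: eq_bigr => h _; rewrite ga_scaleE mulrA.
Qed.

HB.instance Definition _ := GRing.Lmodule_isLalgebra.Build F FG ga_scaleAl.

Fact ga_scaleAr (a : F) u v : a *: (u * v) = u * (a *: v).
Proof.
apply/ffunP=> g; rewrite ga_scaleE !ffunE mulr_sumr.
by apply: eq_bigr => h _; rewrite ga_scaleE mulrCA.
Qed.

HB.instance Definition _ := GRing.Lalgebra_isAlgebra.Build F FG ga_scaleAr.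
HB.instance Definition _ := Algebra_isFalgebra.Build F FG.

Lemma ga_oneE g : (1 : FG) g = (g == 1%g)%:R.
Proof. exact: ffunE. Qed.

Lemma ga_mulE u v g : (u * v) g = \sum_h u h * v (h^-1 * g)%g.
Proof. exact: ffunE. Qed.

End GroupAlgebra.

Section Socle.
Variables (F : fieldType) (L : falgType F).
Implicit Types (A : {aspace L}) (I J S : {vspace L}).

(* Two-sided ideals of a subalgebra A of L. *)
Definition is_ideal A I : bool :=
  [&& (I <= A)%VS, (A * I <= I)%VS & (I * A <= I)%VS].

Definition minimal_ideal A I : Prop :=
  [/\ is_ideal A I, I != 0%VS
    & forall J, is_ideal A J -> J != 0%VS -> (J <= I)%VS -> J = I].

Fact socle_subproof A : exists S : {vspace L}, forall x : L,
  x \in S <-> exists2 Is : seq {vspace L},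
    (forall I, I \in Is -> minimal_ideal A I) & x \in (\sum_(I <- Is) I)%VS.
Proof.
suff [Is minIs maxIs]: exists2 Is : seq {vspace L},
    (forall I, I \in Is -> minimal_ideal A I)
    & forall I, minimal_ideal A I -> (I <= \sum_(I <- Is) I)%VS.
  exists (\sum_(I <- Is) I)%VS => x.
  split=> [Sx | [Js minJs]]; first by exists Is.
  apply: subvP; elim: Js minJs => [|J Js IH] minJs.
    by rewrite big_nil sub0v.
  rewrite big_cons subv_add maxIs /=; last exact/minJs/mem_head.
  by apply: IH => I JsI; apply: minJs; rewrite in_cons JsI orbT.
suff H n : forall Is : seq {vspace L},
    (forall I, I \in Is -> minimal_ideal A I) ->
    (\dim {:L} - \dim (\sum_(I <- Is) I)%VS < n)%N ->
    exists2 Is : seq {vspace L}, (forall I, I \in Is -> minimal_ideal A I)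
      & forall I, minimal_ideal A I -> (I <= \sum_(I <- Is) I)%VS.
  by apply: (H _ [::] _ (ltnSn _)) => I; rewrite in_nil.
elim: n => // n IHn Is minIs ltn.
have [maxIs|] := boolp.EM (forall I, minimal_ideal A I ->
                                     (I <= \sum_(I <- Is) I)%VS).
  by exists Is.
move=> /boolp.existsNP[I /boolp.not_implyP[minI /negP nsI]].
apply: (IHn (I :: Is)) => [J|].
  by rewrite in_cons => /predU1P[-> //|]; apply: minIs.
apply: leq_trans (_ : _ < \dim {:L} - \dim (\sum_(I <- Is) I)%VS)%N ltn.
have lt_dim : (\dim (\sum_(I <- Is) I)%VS < \dim (I + \sum_(I <- Is) I)%VS)%N.
  rewrite ltn_neqAle dimvS ?addvSr // andbT.
  apply: contraNneq nsI => eq_dim.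
  have /eqP-> : (\sum_(I <- Is) I == I + \sum_(I <- Is) I)%VS.
    by rewrite eqEdim addvSr eq_dim leqnn.
  exact: addvSl.
rewrite big_cons ltn_sub2l // (leq_trans lt_dim) //.
exact/dimvS/subvf.
Qed.

(* The sum of the minimal ideals of A, as a subspace; memv_socle below is its
   defining property. *)
Definition socle A : {vspace L} :=
  sval (boolp.constructive_indefinite_description (socle_subproof A)).

Lemma memv_socle A (x : L) :
  x \in socle A <-> exists2 Is : seq {vspace L},
    (forall I, I \in Is -> minimal_ideal A I) & x \in (\sum_(I <- Is) I)%VS.
Proof.
rewrite /socle.
by case: (boolp.constructive_indefinite_description _) => S /= ->.
Qed.

End Socle.

(* Generated by the f g^-1, where {f, g} is a conjugacy class of Q of
   length 2. *)
Definition Y_subgroup (gT : finGroupType) (Q : {set gT}) : {set gT} :=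
  <<[set (x.1 * x.2^-1)%g
      | x : gT * gT & (x.1 != x.2) && ([set x.1; x.2] \in classes Q)]>>%g.

(* Main.v *)
Require Import Defs.
From mathcomp Require Import all_boot all_order all_fingroup all_algebra.
From mathcomp Require Import all_solvable all_field.

Set Implicit Arguments.
Unset Strict Implicit.
Unset Printing Implicit Defensive.

Import GRing.Theory.
Local Open Scope ring_scope.

(** Write [P] for [O_p(G)] and [A] for [FG].  Both hypotheses give [G'] inside
    [P], so [P] is a Sylow subgroup and [G = P H] for a [p']-group [H].

    The hypotheses enter only through differences of group elements: call
    [u - v] good if [u] and [v] are commuting elements of [P] and [u - v]
    centralizes [P].  Good differences are nilpotent in characteristic [p].  For
    [c] in [Z(P)], [c - 1] is good; when [p = 2] and [{u, v}] is a class of [P],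
    [u - v = u + v] is good ([central_difference], [class2_difference]).  So in
    either case [G'] lies in the group generated by the quotients [u v^-1] of
    the good differences.  Consequently an element [w] of [A] that is killed by
    all good differences satisfies [w g = w] for [g] in [G'].  This makes [w]
    central: its coefficients are constant on the cosets of [G'], and a
    conjugate of [x] lies in the coset of [x].

    The heart is to show that each [z] in the socle of [Z(A)] is killed by all
    good differences ([socle_center_ideal_of_differences]).  They lie in the
    commutative algebra [Z = Z(C_A(P))], on which [H] acts by conjugation, and
    are nilpotent.  If [z] is not killed by one of them, then some nilpotent
    [b] in [Z] has [z b <> 0] while [z b] is killed by all of them
    ([nilpotent_common_kernel]).  By the previous paragraph [z b] is then
    central, hence fixed by [H], so summing its conjugates over [H] gives
    [#|H| (z b) = z t], where [t] is the sum of the conjugates of [b].  But [t]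
    is central in [A] and nilpotent, so it kills the socle, and [#|H|] is
    invertible in [F]: thus [z b = 0], a contradiction.

    It follows that [z y = y z] is killed by the good differences for every [y]
    in [A], so [z A] is central.  Multiplication by [y] then maps minimal ideals
    of [Z(A)] to zero or to minimal ideals of [Z(A)], hence preserves the
    socle ([socle_center_ideal]). *)

(** * Nilpotent elements *)

Definition is_nilpotent (R : pzRingType) (x : R) := exists n, x ^+ n = 0.

Section Nilpotent.
Variable R : pzRingType.
Implicit Types x y : R.

Lemma is_nilpotent0 : is_nilpotent (0 : R).
Proof. by exists 1%N; rewrite expr1. Qed.

Lemma is_nilpotentM x y :
  GRing.comm x y -> is_nilpotent x -> is_nilpotent (x * y).
Proof. by move=> cxy [n xn0]; exists n; rewrite exprMn_comm // xn0 mul0r. Qed.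

Lemma is_nilpotentD x y : GRing.comm x y ->
  is_nilpotent x -> is_nilpotent y -> is_nilpotent (x + y).
Proof.
move=> cxy [m xm0] [n yn0]; exists (m + n)%N.
rewrite exprDn_comm // big1 // => i _.
have [le_ni | lt_in] := leqP n i.
  by rewrite -(subnK le_ni) exprD yn0 !mulr0 mul0rn.
have le_m : (m <= m + n - i)%N by rewrite -addnBA ?leq_addr // ltnW.
by rewrite -(subnK le_m) exprD xm0 mulr0 mul0r mul0rn.
Qed.

End Nilpotent.

Lemma exprB_pchar (R : nzRingType) p k (x y : R) :
  p \in [pchar R] -> GRing.comm x y ->
  (x - y) ^+ (p ^ k) = x ^+ (p ^ k) - y ^+ (p ^ k).
Proof.
move=> pR cxy; elim: k => [|k IHk]; first by rewrite !expr1.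
rewrite expnSr !exprM IHk -!(pFrobenius_autE pR) pFrobenius_autB_comm //.
by apply/commrX/commr_sym/commrX/commr_sym.
Qed.

Section Algebra.
Variables (F : fieldType) (L : falgType F).
Implicit Types (A : {aspace L}) (I J V : {vspace L}) (w x y z : L).

Lemma cent_spanP x (s : seq L) :
  reflect {in s, forall y, x * y = y * x} (x \in 'C(<<s>>)%VS).
Proof.
rewrite -subv_cent1; apply: (iffP span_subvP) => cxs y /cxs.
  by move/cent1vP.
by move=> cxy; apply/cent1vP.
Qed.

Lemma nilpotent_sum A (T : finType) (D : {pred T}) (f : T -> L) :
  (A <= 'C(A))%VS -> (forall i, i \in D -> f i \in A /\ is_nilpotent (f i)) ->
  is_nilpotent (\sum_(i in D) f i).
Proof.
move=> /centvsP cAA fD.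
suff [] : (\sum_(i in D) f i \in A) /\ is_nilpotent (\sum_(i in D) f i) by [].
apply: (big_ind (fun x => x \in A /\ is_nilpotent x)) => //.
  by split; [apply: mem0v | apply: is_nilpotent0].
move=> x y [Ax nx] [Ay ny]; split; first exact: memvD.
exact: is_nilpotentD (cAA _ _ _ _) nx ny.
Qed.

(** Commuting nilpotent operators on a nonzero space have a common kernel
    vector; here they are the right multiplications by the elements of [s], on
    the space [w * A].  Multiplying by the last nonvanishing power of each
    element in turn reaches such a vector. *)
Lemma nilpotent_common_kernel A w (s : seq L) :
    1 \in A -> (A <= 'C(A))%VS ->
    {in s, forall c, c \in A /\ is_nilpotent c} -> w != 0 ->
  exists m, [/\ m \in A, w * m != 0 & {in s, forall c, w * m * c = 0}].
Proof.
move=> A1 /centvsP cAA nils w0; elim: s nils => [|c s IHs] nils.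
  by exists 1; rewrite mulr1.
have [m [Am wm0 wms]] : exists m,
    [/\ m \in A, w * m != 0 & {in s, forall c, w * m * c = 0}].
  by apply: IHs => d sd; apply: nils; rewrite inE sd orbT.
have [Ac [n cn0]] : c \in A /\ is_nilpotent c by apply: nils; rewrite mem_head.
have Ack i : c ^+ i \in A.
  by elim: i => [|i Ai]; rewrite ?expr0 // exprS memvM.
have kill : exists n, w * m * c ^+ n == 0 by exists n; rewrite cn0 mulr0.
case: (ex_minnP kill) => [[|k]] wmck min_k.
  by rewrite mulr1 (negPf wm0) in wmck.
exists (m * c ^+ k); split; first by apply: memvM Am (Ack k).
  by rewrite mulrA; apply/negP=> /min_k; rewrite ltnn.
move=> d; rewrite inE => /predU1P[-> | sd].
  by rewrite mulrA -mulrA -exprSr (eqP wmck).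
have [Ad _] : d \in A /\ is_nilpotent d by apply: nils; rewrite inE sd orbT.
have cdck : GRing.comm d (c ^+ k) by apply/commrX/cAA.
by rewrite mulrA -mulrA -cdck mulrA wms ?mul0r.
Qed.

(** * The socle of the center *)

Lemma socle_sub A V :
  (forall I, minimal_ideal A I -> (I <= V)%VS) -> (socle A <= V)%VS.
Proof.
move=> minV; apply/subvP=> x /memv_socle[Is minIs]; apply: subvP.
elim: Is minIs => [|I Is IHs] minIs; first by rewrite big_nil sub0v.
rewrite big_cons subv_add minV /=; last exact/minIs/mem_head.
by apply: IHs => J IsJ; apply: minIs; rewrite inE IsJ orbT.
Qed.

Lemma minimal_sub_socle A I : minimal_ideal A I -> (I <= socle A)%VS.
Proof.
move=> minI; apply/subvP=> x Ix; apply/memv_socle; exists [:: I].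
  by move=> J; rewrite inE => /eqP->.
by rewrite big_seq1.
Qed.

Lemma ideal_memM A I :
  reflect [/\ (I <= A)%VS, {in A & I, forall a x, a * x \in I}
            & {in I & A, forall x a, x * a \in I}] (is_ideal A I).
Proof.
by apply: (iffP and3P) => -[sIA /prodvP AI /prodvP IA].
Qed.

Lemma mem_amulr_img I y x :
  reflect (exists2 i, i \in I & x = i * y) (x \in (amulr y @: I)%VS).
Proof.
apply: (iffP memv_imgP) => -[i Ii ->]; exists i => //; by rewrite lfunE.
Qed.

Lemma mem_amulr_preim I y x : (x \in (amulr y @^-1: I)%VS) = (x * y \in I).
Proof. by rewrite -memv_preim lfunE. Qed.

(** A minimal ideal [I] of a commutative algebra contains the ideal [I a], so
    [I a] is [I] or [0], and [I a = I] would give [I = I a^n = 0]. *)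
Lemma socle_mul_nilpotent A x a :
    (A <= 'C(A))%VS -> x \in socle A -> a \in A -> is_nilpotent a ->
  x * a = 0.
Proof.
move=> /centvsP cAA soc_x Aa [n an0].
suff /subvP/(_ x soc_x) : (socle A <= lker (amulr a))%VS.
  by rewrite memv_ker lfunE => /eqP.
apply: socle_sub => I [/ideal_memM[sIA AI IA] I0 minI].
rewrite lkerE; apply: contraNT I0 => J0.
have defI : (amulr a @: I)%VS = I.
  apply: minI J0 _; last first.
    by apply/subvP=> _ /mem_amulr_img[i Ii ->]; apply: IA.
  apply/ideal_memM; split.
  - by apply/subvP=> _ /mem_amulr_img[i Ii ->]; apply: (subvP sIA); apply: IA.
  - move=> b _ Ab /mem_amulr_img[i Ii ->]; apply/mem_amulr_img.
    by exists (b * i); rewrite ?mulrA ?AI.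
  move=> _ b /mem_amulr_img[i Ii ->] Ab; apply/mem_amulr_img.
  by exists (i * b); rewrite ?IA // -!mulrA (cAA a b).
rewrite -subv0; apply/subvP=> y Iy.
have [i _ ->] : exists2 i, i \in I & y = i * a ^+ n.
  elim: (n) {an0} => [|k [i Ii ->]]; first by exists y; rewrite ?mulr1.
  move: Ii; rewrite -{1}defI => /mem_amulr_img[j Ij ->].
  by exists j; rewrite // -mulrA -exprS.
by rewrite an0 mulr0 mem0v.
Qed.

Lemma center_comm z x : z \in 'Z({:L})%AS -> z * x = x * z.
Proof. by rewrite memv_cap => /andP[_ /centvP->] //; apply: memvf. Qed.

Lemma memv_center z : (forall x, z * x = x * z) -> z \in 'Z({:L})%AS.
Proof. by move=> cz; rewrite memv_cap memvf; apply/centvP=> x _. Qed.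

(** Multiplication by [y] sends a minimal ideal of the center, as a module
    over the center, onto a quotient: zero or again simple.  Hence the socle
    is stable under multiplication by [y] once these images are central. *)
Lemma socle_center_ideal :
    (forall x y, x \in socle 'Z({:L})%AS -> x * y \in 'Z({:L})%AS) ->
  is_ideal {:L}%AS (socle 'Z({:L})%AS).
Proof.
move=> soc_cent; set A := 'Z({:L})%AS.
have socA x : x \in socle A -> x \in A.
  by move=> soc_x; rewrite -[x]mulr1 soc_cent.
have soc_mulr x y : x \in socle A -> x * y \in socle A.
  suff /subvP s_soc : (socle A <= amulr y @^-1: socle A)%VS.
    by move/s_soc; rewrite mem_amulr_preim.
  apply: socle_sub => I minI; have [/ideal_memM[sIA AI IA] I0 I_min] := minI.
  have sI_soc := subvP (minimal_sub_socle minI).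
  have [J0 | J0] := eqVneq (amulr y @: I)%VS 0%VS.
    apply/subvP=> i /(memv_img (amulr y)).
    by rewrite J0 memv0 -memv_preim => /eqP->; apply: mem0v.
  have minJ : minimal_ideal A (amulr y @: I)%VS.
    split=> // [|J' /ideal_memM[sJA AJ JA] J'0 sJ'J].
      apply/ideal_memM; split.
      - by apply/subvP=> _ /mem_amulr_img[i Ii ->]; apply/soc_cent/sI_soc.
      - move=> b _ Ab /mem_amulr_img[i Ii ->]; apply/mem_amulr_img.
        by exists (b * i); rewrite ?mulrA ?AI.
      move=> _ b /mem_amulr_img[i Ii ->] Ab; apply/mem_amulr_img.
      by exists (i * b); rewrite ?IA // -!mulrA (center_comm y Ab).
    have defI : (I :&: amulr y @^-1: J')%VS = I.
      apply: I_min; last exact: capvSl; last first.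
        have [j J'j j0] : exists2 j, j \in J' & j != 0.
          by exists (vpick J'); rewrite ?memv_pick ?vpick0.
        have /mem_amulr_img[i Ii def_j] := subvP sJ'J j J'j.
        apply: contraNneq j0 => cap0; suff : i \in 0%VS.
          by rewrite memv0 def_j => /eqP->; rewrite mul0r.
        by rewrite -cap0 memv_cap Ii mem_amulr_preim -def_j.
      apply/ideal_memM; split.
      - exact: subv_trans (capvSl _ _) sIA.
      - move=> b i Ab; rewrite !memv_cap !mem_amulr_preim => /andP[Ii J'iy].
        by rewrite AI // -mulrA AJ.
      move=> i b Ii' Ab; move: Ii'.
      rewrite !memv_cap !mem_amulr_preim => /andP[Ii J'iy].
      by rewrite IA // -mulrA (center_comm y Ab) mulrA JA.
    apply/eqP; rewrite eqEsubv sJ'J; apply/subvP=> _ /mem_amulr_img[i Ii ->].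
    by move: Ii; rewrite -{1}defI memv_cap mem_amulr_preim => /andP[].
  apply/subvP=> i Ii; rewrite -memv_preim.
  exact: subvP (minimal_sub_socle minJ) _ (memv_img _ Ii).
apply/ideal_memM; split=> [|y x _ soc_x|x y soc_x _]; first exact: subvf.
  by rewrite -(center_comm y (socA x soc_x)) soc_mulr.
exact: soc_mulr.
Qed.

End Algebra.

(** * The group algebra *)

Section GroupAlgebraTheory.
Variables (F : fieldType) (gT : finGroupType).
Local Notation FG := (group_algebra F gT).
Implicit Types (w x y z : FG) (P H : {group gT}).

Definition ga (g : gT) : FG := [ffun h => (h == g)%:R].

Lemma gaE g h : ga g h = (h == g)%:R.
Proof. exact: ffunE. Qed.

Lemma ga_mulrE x g h : (x * ga g) h = x (h * g^-1)%g.
Proof.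
rewrite ga_mulE (bigD1 (h * g^-1)%g) //= gaE invMg invgK mulgKV eqxx mulr1.
rewrite big1 ?addr0 // => k /negPf nk; rewrite gaE.
by rewrite (canF_eq (mulKVg _)) eq_sym (canF_eq (mulgK _)) nk mulr0.
Qed.

Lemma ga_mullE x g h : (ga g * x) h = x (g^-1 * h)%g.
Proof.
rewrite ga_mulE (bigD1 g) //= gaE eqxx mul1r.
by rewrite big1 ?addr0 // => k /negPf nk; rewrite gaE nk mul0r.
Qed.

Lemma ga1 : ga 1%g = 1.
Proof. by apply/ffunP=> h; rewrite ga_oneE. Qed.

Lemma gaM g h : ga (g * h)%g = ga g * ga h.
Proof. by apply/ffunP=> k; rewrite ga_mullE !gaE (canF_eq (mulKVg _)). Qed.

Lemma gaX g n : ga (g ^+ n)%g = ga g ^+ n.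
Proof. by elim: n => [|n IHn]; rewrite ?ga1 // expgS exprS gaM IHn. Qed.

Lemma ga_sum x : x = \sum_g x g *: ga g.
Proof.
apply/ffunP=> h; rewrite sum_ffunE (bigD1 h) //= ga_scaleE gaE eqxx mulr1.
rewrite big1 ?addr0 // => g /negPf nhg.
by rewrite ga_scaleE gaE eq_sym nhg mulr0.
Qed.

Lemma ga_center z :
  (forall g, z * ga g = ga g * z) -> z \in 'Z({:FG})%AS.
Proof.
move=> cz; apply: memv_center => x; rewrite [x]ga_sum mulr_sumr mulr_suml.
by apply: eq_bigr => g _; rewrite -scalerAr -scalerAl cz.
Qed.

(** Right multiplication of [w] by [g] shifts coefficients, so invariance under
    [G'] says that the coefficients of [w] are constant on the cosets of [G'];
    conjugation moves no element out of its coset. *)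
Lemma derg_invariant_center w :
    (forall g, g \in [set: gT]^`(1)%g -> w * ga g = w) ->
  w \in 'Z({:FG})%AS.
Proof.
move=> invw; apply: ga_center => g; apply/ffunP=> x.
rewrite ga_mulrE ga_mullE -[in RHS](invw [~ (g^-1 * x), g^-1]^-1)%g.
  by rewrite ga_mulrE invgK -conjg_mulR conjgE invgK -!mulgA mulKVg.
by rewrite groupV mem_commg ?inE.
Qed.

(** [w u = w v] means that [u v^-1] lies in the right stabilizer of [w], which
    is a subgroup. *)
Lemma gen_invariant w (T : {set gT * gT}) :
    {in T, forall c, w * (ga c.1 - ga c.2) = 0} ->
  {in <<[set (c.1 * c.2^-1)%g | c in T]>>%g, forall g, w * ga g = w}.
Proof.
move=> wT; pose S := [set g | w * ga g == w].
have gS : group_set S.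
  apply/group_setP; split=> [|g h]; first by rewrite inE ga1 mulr1.
  by rewrite !inE gaM mulrA => /eqP->.
suff sTS : <<[set (c.1 * c.2^-1)%g | c in T]>>%g \subset Group gS.
  by move=> g /(subsetP sTS); rewrite inE => /eqP.
rewrite gen_subG; apply/subsetP=> _ /imsetP[[u v] Tc ->] /=.
rewrite inE gaM mulrA; have /eqP := wT _ Tc.
by rewrite /= mulrBr subr_eq0 => /eqP->; rewrite -mulrA -gaM mulgV ga1 mulr1.
Qed.

Definition ga_conj (h : gT) x : FG := ga h^-1%g * x * ga h.

Lemma ga_conjM h x y : ga_conj h (x * y) = ga_conj h x * ga_conj h y.
Proof.
by rewrite /ga_conj !mulrA -(mulrA (_ * x) (ga h)) -gaM mulgV ga1 mulr1.
Qed.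

Lemma ga_conj_comp g h x : ga_conj g (ga_conj h x) = ga_conj (h * g)%g x.
Proof. by rewrite /ga_conj invMg !gaM !mulrA. Qed.

Lemma ga_conj1 x : ga_conj 1%g x = x.
Proof. by rewrite /ga_conj invg1 ga1 mulr1 mul1r. Qed.

Lemma ga_conj_ga g h : ga_conj h (ga g) = ga (g ^ h)%g.
Proof. by rewrite /ga_conj conjgE !gaM mulrA. Qed.

Lemma ga_conj_fix h x : ga_conj h x = x <-> x * ga h = ga h * x.
Proof.
split=> [fx | cxh].
  by rewrite -[in RHS]fx /ga_conj !mulrA -gaM mulgV ga1 mul1r.
by rewrite /ga_conj -mulrA cxh mulrA -gaM mulVg ga1 mul1r.
Qed.

Lemma ga_conj_nilpotent h x : is_nilpotent x -> is_nilpotent (ga_conj h x).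
Proof.
case=> n xn0; exists n.
suff -> : ga_conj h x ^+ n = ga_conj h (x ^+ n).
  by rewrite xn0 /ga_conj mulr0 mul0r.
elim: n {xn0} => [|n IHn]; last by rewrite !exprS IHn ga_conjM.
by rewrite !expr0 -ga1 ga_conj_ga conj1g.
Qed.

(** The algebra [C_FG(P)].  Its center contains [Z(FP)], and membership in it
    is a matter of commutation alone, without conditions on supports. *)
Definition cent_ga P := 'C(<<[seq ga g | g in P]>>)%AS.

Lemma cent_gaP P x :
  reflect {in P, forall g, x * ga g = ga g * x} (x \in cent_ga P).
Proof.
apply: (iffP (cent_spanP _ _)) => cx g.
  by move=> Pg; apply/cx/image_f.
by case/imageP=> h Ph ->; apply: cx.
Qed.

Lemma center_cent_gaP P x :
  reflect (x \in cent_ga P /\ {in cent_ga P, forall y, x * y = y * x})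
          (x \in 'Z(cent_ga P)%AS).
Proof.
by rewrite memv_cap; apply: (iffP andP) => -[Cx /centvP cx].
Qed.

Lemma center_cent_ga_comm P : ('Z(cent_ga P) <= 'C('Z(cent_ga P)))%VS.
Proof. by apply: subv_trans (centerv_sub _) (cent_centerv _). Qed.

Lemma ga_sub_center_cent P u v : u \in P -> v \in P ->
  ga u - ga v \in cent_ga P -> ga u - ga v \in 'Z(cent_ga P)%AS.
Proof.
move=> Pu Pv Cuv; apply/center_cent_gaP; split=> // y /cent_gaP cy.
by rewrite mulrBl mulrBr !cy.
Qed.

Lemma ga_conj_cent P h x :
  h \in 'N(P)%g -> x \in cent_ga P -> ga_conj h x \in cent_ga P.
Proof.
move=> nPh /cent_gaP cx; apply/cent_gaP=> g Pg.
by rewrite -[g](conjgKV h) -ga_conj_ga -!ga_conjM cx ?memJ_norm ?groupV.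
Qed.

Lemma ga_conj_center_cent P h x :
  h \in 'N(P)%g -> x \in 'Z(cent_ga P)%AS -> ga_conj h x \in 'Z(cent_ga P)%AS.
Proof.
move=> nPh /center_cent_gaP[Cx cx]; apply/center_cent_gaP.
split=> [|y Cy]; first exact: ga_conj_cent.
rewrite -[y]ga_conj1 -(mulVg h) -ga_conj_comp -!ga_conjM cx //.
by apply: ga_conj_cent; rewrite ?groupV.
Qed.

Lemma trace_center P H x :
    (P <| [set: gT])%g -> (P * H)%g = [set: gT] -> x \in 'Z(cent_ga P)%AS ->
  \sum_(h in H) ga_conj h x \in 'Z({:FG})%AS.
Proof.
move=> /andP[_ nPG] defG Zx; have nP h : h \in 'N(P)%g.
  by rewrite (subsetP nPG) ?inE.
have /center_cent_gaP[/cent_gaP cPt _] :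
    \sum_(h in H) ga_conj h x \in 'Z(cent_ga P)%AS.
  by apply: memv_suml => h _; apply: ga_conj_center_cent.
apply: ga_center => g; have /mulsgP[u k Pu Hk ->] : g \in (P * H)%g.
  by rewrite defG inE.
suff ck : (\sum_(h in H) ga_conj h x) * ga k =
          ga k * (\sum_(h in H) ga_conj h x).
  by rewrite gaM mulrA cPt // -!mulrA ck.
apply/ga_conj_fix; rewrite {1}/ga_conj mulr_sumr mulr_suml.
rewrite [RHS](reindex_inj (mulIg k)) /=.
apply: eq_big => h; first by rewrite groupMr.
by move=> _; rewrite -ga_conj_comp.
Qed.

(** In characteristic [p], the [|P|]-th power of [u - v] is
    [u ^ |P| - v ^ |P| = 1 - 1]. *)
Lemma ga_sub_nilpotent p P u v :
    p \in [pchar F] -> (p.-group P)%g -> u \in P -> v \in P -> commute u v ->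
  is_nilpotent (ga u - ga v).
Proof.
move=> charF pP Pu Pv cuv; exists #|P|.
have [k oP] := p_natP pP; rewrite oP exprB_pchar ?pchar_lalg //.
  by rewrite -oP -!gaX !expg_cardG // subrr.
by rewrite /GRing.comm -!gaM cuv.
Qed.

(** The averaging argument.  A pair [c] in [T] stands for the difference
    [c.1 - c.2]. *)
Theorem socle_center_ideal_of_differences p P H (T : {set gT * gT}) :
    p \in [pchar F] -> (p.-group P)%g -> (P <| [set: gT])%g ->
    (P * H)%g = [set: gT] -> (p^'.-group H)%g ->
    {in T, forall c, [/\ c.1 \in P, c.2 \in P, commute c.1 c.2
                       & ga c.1 - ga c.2 \in cent_ga P]} ->
    [set: gT]^`(1)%g \subset <<[set (c.1 * c.2^-1)%g | c in T]>>%g ->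
  is_ideal {:FG}%AS (socle 'Z({:FG})%AS).
Proof.
move=> charF pP nsPG defG p'H TP sG'T.
set Z := 'Z(cent_ga P)%AS.
have cZZ := center_cent_ga_comm P.
have commZ x y : x \in Z -> y \in Z -> GRing.comm x y by apply/centvsP.
have nilT : {in T, forall c,
    ga c.1 - ga c.2 \in Z /\ is_nilpotent (ga c.1 - ga c.2)}.
  move=> c /TP[Pu Pv cuv Cuv]; split; first exact: ga_sub_center_cent.
  exact: ga_sub_nilpotent charF pP Pu Pv cuv.
have H_neq0 : #|H|%:R != 0 :> F.
  by rewrite -(dvdn_pcharf charF) -p'natE ?(pcharf_prime charF).
have cAA : ('Z({:FG}) <= 'C('Z({:FG})))%VS.
  by apply: subv_trans (centerv_sub _) (cent_centerv _).
have killT_central w :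
    {in T, forall c, w * (ga c.1 - ga c.2) = 0} -> w \in 'Z({:FG})%AS.
  move/gen_invariant=> invw; apply: derg_invariant_center => g.
  by move/(subsetP sG'T)/invw.
have soc_killT z : z \in socle 'Z({:FG})%AS ->
    {in T, forall c, z * (ga c.1 - ga c.2) = 0}.
  move=> soc_z c Tc; set a := ga _ - _.
  have [Za nil_a] : a \in Z /\ is_nilpotent a by apply: nilT.
  have zC x : z * x = x * z.
    apply: center_comm; apply: subvP (socle_sub _) z soc_z.
    by move=> I [/and3P[]].
  apply/eqP; apply: contraT => za0.
  have [| |m [Zm zam0 zamT]] := nilpotent_common_kernel
      (s := [seq ga d.1 - ga d.2 | d in T]) _ cZZ _ za0.
  - apply/center_cent_gaP; split=> [|y _]; first exact: centv1.
    by rewrite mulr1 mul1r.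
  - by move=> _ /imageP[d Td ->]; apply: nilT.
  set b := a * m; have Zb : b \in Z by apply: memvM.
  have nil_b : is_nilpotent b by apply: is_nilpotentM => //; apply: commZ.
  have cent_zb : z * b \in 'Z({:FG})%AS.
    by apply: killT_central => d Td; rewrite mulrA zamT ?image_f.
  have conjZ h : ga_conj h b \in Z.
    apply: ga_conj_center_cent => //.
    by rewrite (subsetP (normal_norm nsPG)) ?inE.
  have : z * (\sum_(h in H) ga_conj h b) = 0.
    apply: socle_mul_nilpotent cAA soc_z _ _; first exact: trace_center defG Zb.
    apply: nilpotent_sum cZZ _ => h _; split=> //.
    exact: ga_conj_nilpotent.
  (* Each conjugate of [b] has the same product with [z], since [z] and [z b]
     are both central. *)
  rewrite mulr_sumr (eq_bigr (fun _ => z * b)) => [|h _]; last first.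
    rewrite /ga_conj mulrA mulrA (zC (ga _)) -(mulrA _ z).
    by apply/ga_conj_fix/center_comm.
  rewrite sumr_const -scaler_nat => /eqP.
  by rewrite scaler_eq0 (negPf H_neq0) mulrA (negPf zam0).
apply: socle_center_ideal => z y soc_z.
have soc_central : z \in 'Z({:FG})%AS := killT_central z (soc_killT z soc_z).
apply: killT_central => c Tc.
by rewrite (center_comm y soc_central) -mulrA soc_killT ?mulr0.
Qed.

Lemma central_difference P c : c \in 'Z(P)%g ->
  [/\ c \in P, 1%g \in P, commute c 1 & ga c - ga 1%g \in cent_ga P].
Proof.
case/setIP=> Pc /centP cPc; split=> //; first exact: commute1.
by apply/cent_gaP=> g Pg; rewrite mulrBl mulrBr -!gaM mulg1 mul1g cPc.
Qed.

(** Conjugation by [u] fixes [u], so it cannot move [v].  Conjugation by an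
    element of [P] at worst swaps [u] and [v], which in characteristic 2
    preserves [u - v = u + v]. *)
Lemma class2_difference P (u v : gT) :
    2 \in [pchar F] -> u != v -> [set u; v] \in classes P ->
  [/\ u \in P, v \in P, commute u v & ga u - ga v \in cent_ga P].
Proof.
move=> char2 neq_uv /imsetP[w Pw defD].
have sDP : [set u; v] \subset P by rewrite defD class_subG.
have Pu : u \in P by rewrite (subsetP sDP) ?set21.
have Pv : v \in P by rewrite (subsetP sDP) ?set22.
have DJ (a g : gT) : a \in [set u; v] -> g \in P -> (a ^ g)%g \in [set u; v].
  by rewrite defD => /class_eqP<- Pg; apply: memJ_class.
split=> //.
  have /set2P[/(canRL (conjgK u)) | ] := DJ v u (set22 u v) Pu.
    rewrite conjgE invgK mulgV mulg1 => def_v.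
    by rewrite def_v eqxx in neq_uv.
  by move/conjg_fixP/commgP/commute_sym.
apply/cent_gaP=> g Pg; apply/ga_conj_fix.
have -> : ga_conj g (ga u - ga v) = ga (u ^ g)%g - ga (v ^ g)%g.
  by rewrite -!ga_conj_ga /ga_conj mulrBr mulrBl.
have neqJ : (u ^ g != v ^ g)%g by rewrite (inj_eq (conjg_inj g)).
have /set2P[eqJu | eqJu] := DJ u g (set21 u v) Pg.
  have /set2P[eqJv | -> ] := DJ v g (set22 u v) Pg; last by rewrite eqJu.
  by rewrite eqJu eqJv eqxx in neqJ.
have /set2P[-> | eqJv] := DJ v g (set22 u v) Pg; last first.
  by rewrite eqJu eqJv eqxx in neqJ.
have char2FG : 2 \in [pchar FG] by rewrite pchar_lalg.
by rewrite eqJu !(oppr_pchar2 char2FG) addrC.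
Qed.

End GroupAlgebraTheory.

(** * Splitting over the p-core *)

(** As [G'] lies in [O_p(G)], every Sylow [p]-subgroup is normal, and
    Schur-Zassenhaus applies. *)
Lemma pcore_complement (p : nat) (gT : finGroupType) (G : {group gT}) :
    (G^`(1) \subset 'O_p(G))%g ->
  exists2 H : {group gT}, ('O_p(G) * H = G)%g & (p^'.-group H)%g.
Proof.
move=> sG'P; have [S sylS] := Sylow_exists p G.
have sPS : ('O_p(G) \subset S)%g by apply: pcore_sub_Hall sylS.
have nsSG : (S <| G)%g.
  by apply: sub_der1_normal (subset_trans sG'P sPS) (pHall_sub sylS).
have defP : 'O_p(G)%g = S by apply: normal_Hall_pcore.
have /splitsP[H /complP[tiSH defG]] :=
  SchurZassenhaus_split (pHall_Hall sylS) nsSG.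
exists H; first by rewrite defP.
have -> : (p^'.-group H = p^'.-nat #|G : S|)%g.
  by rewrite /pgroup -divgS ?(pHall_sub sylS) // -defG (TI_cardMg tiSH) mulKn.
by case/and3P: sylS.
Qed.

(** * The two hypotheses on the derived subgroup *)

Theorem theorem3 (F : fieldType) (p : nat) (gT : finGroupType)
    (charF : p \in [pchar F]%R)
    (G := [set: gT]%G)
    (hG : (G^`(1) \subset 'Z('O_p(G)))%g
       \/ p = 2%N
          /\ (G^`(1) \subset Y_subgroup 'O_p(G) * 'Z('O_p(G)))%g) :
  is_ideal {:group_algebra F gT}%AS
           (socle 'Z({:group_algebra F gT})%AS).
Proof.
pose P := 'O_p(G)%G.
pose good (c : gT * gT) := [/\ c.1 \in P, c.2 \in P, commute c.1 c.2
  & ga F c.1 - ga F c.2 \in cent_ga F P].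
pose T1 : {set gT * gT} := [set (c, 1%g) | c in 'Z(P)%g].
have T1good : {in T1, forall c, good c}.
  by move=> _ /imsetP[c Zc ->]; apply: central_difference.
suff [T Tgood sG'T] : exists2 T : {set gT * gT}, {in T, forall c, good c}
    & (G^`(1) \subset <<[set c.1 * c.2^-1 | c in T]>>)%g.
  have pP : (p.-group P)%g by apply: pcore_pgroup.
  have sG'P : (G^`(1) \subset P)%g.
    apply: subset_trans sG'T _; rewrite gen_subG.
    apply/subsetP=> _ /imsetP[c /Tgood[Pu Pv _ _] ->].
    by rewrite groupM ?groupV.
  have [H defG p'H] := pcore_complement sG'P.
  exact: (socle_center_ideal_of_differences charF pP (pcore_normal _ _)
            defG p'H Tgood sG'T).
have sZT1 : ('Z(P) \subset [set c.1 * c.2^-1 | c in T1])%g.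
  apply/subsetP=> c Zc; apply/imsetP; exists (c, 1%g); first exact: imset_f.
  by rewrite /= invg1 mulg1.
case: hG => [sG'Z | [p2 sG'YZ]].
  exists T1 => //.
  exact: subset_trans sG'Z (subset_trans sZT1 (subset_gen _)).
pose T2 := [set x : gT * gT | (x.1 != x.2) && ([set x.1; x.2] \in classes P)].
exists (T1 :|: T2).
  move=> c /setUP[/T1good // | ]; rewrite inE => /andP[neq cl].
  by apply: class2_difference neq cl; rewrite p2 in charF.
apply: subset_trans sG'YZ _; apply: mul_subG.
  exact/genS/imsetS/subsetUr.
apply: subset_trans sZT1 (subset_trans _ (subset_gen _)).
exact/imsetS/subsetUl.
Qed.
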